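(* Let $k$ be a positive integer and $n \ge 2$. (a) If $n\le k+2$, then $\dim_{k,f}(P_n)=1$. (b) If $k+3\le n\le 2k+3$, then $\dim_{k,f}(P_n)=\frac{6+2k-n}{5+2k-n}$. (c) Let $n\ge 2k+4$. (i) If $n \equiv 1 \pmod{2k+2}$, then $\dim_{k,f}(P_n)=\frac{n+k}{2k+2}$. (ii) If $n \equiv j \pmod{2k+2}$ for some $j\in\{2, 3, \ldots, k+2\}$, then $\dim_{k,f}(P_n)=\lceil\frac{n}{2k+2}\rceil$. (iii) If $n\equiv 0 \pmod{2k+2}$ or $n\equiv j \pmod{2k+2}$ for some $j\in\{k+3, k+4, \ldots, 2k+1\}$, then $\lceil\frac{n}{2k+2}\rceil \le \dim_{k,f}(P_n) \le \lceil\frac{n}{2k+2}\rceil +\frac{1}{2}$.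
   Context: $P_n$ is the path on $n$ vertices. $d(x,y)$ is the distance in $G$. For a positive integer $k$, $d_k(x,y)=\min\{d(x,y),k+1\}$ and $R_k\{x,y\}=\{z\in V(G): d_k(x,z)\neq d_k(y,z)\}$. For a function $g$ on $V(G)$ and $U\subseteq V(G)$, $g(U)=\sum_{s\in U}g(s)$. A function $h:V(G)\to[0,1]$ is a $k$-truncated resolving function of $G$ if $h(R_k\{x,y\})\ge 1$ for all distinct $x,y\in V(G)$; $\dim_{k,f}(G)$ is the minimum of $h(V(G))$ over all such $h$. *)

(* Defs.v *)
From HB Require Import structures.
From mathcomp Require Import all_boot all_order all_algebra.
From mathcomp Require Import classical_sets reals.
Set Implicit Arguments. Unset Strict Implicit. Unset Printing Implicit Defensive.
Import Order.TTheory GRing.Theory Num.Theory.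
Local Open Scope ring_scope.

(* The path P_n: vertex set 'I_n = {0,...,n-1}, i adjacent to i+1.
   Its graph distance is |i - j|. *)
Definition path_dist (n : nat) (x y : 'I_n) : nat := ((x - y) + (y - x))%N.

Definition dtrunc (k n : nat) (x y : 'I_n) : nat := minn (path_dist x y) k.+1.

Definition Rk (k n : nat) (x y : 'I_n) : {set 'I_n} :=
  [set z | dtrunc k x z != dtrunc k y z].

Definition ktrunc_resolving (R : realType) (k n : nat) (h : 'I_n -> R) : Prop :=
  (forall v, 0 <= h v <= 1) /\
  (forall x y : 'I_n, x != y -> 1 <= \sum_(z in Rk k x y) h z).

(* dim_{k,f}(P_n) : the minimum (= infimum) of h(V) over all such h *)
Definition dimkf (R : realType) (k n : nat) : R :=
  inf (fun r : R => exists h : 'I_n -> R,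
         ktrunc_resolving k h /\ r = \sum_(v : 'I_n) h v).

Definition ceilR (R : realType) (x : R) : R := (Num.ceil x)%:~R.

(* Main.v *)
(* Write B(x) for the ball of radius k around x and N = 2k+2.  For x < y the set
   R_k{x,y} is B(x) union B(y) without the midpoint of x and y; so R_k{x,x+1} is an
   interval of length at most N, and of length k+2 if x or x+1 is an end of the path.

   Lower bounds: if n >= (p-1)N + 2, then p sets R_k{x,x+1} fit disjointly into the
   path, so dim >= p.  If n = qN + 1, then q+1 such intervals cover the path, meeting
   only in c = k+1, while R_k{c-1,c+1} avoids c and is disjoint from q-1 more
   intervals; adding these 2q+1 inequalities gives dim >= q + 1/2.  If
   k+3 <= n <= 2k+3, each of the m = 2k+4-n common vertices c of R_k{0,1} and
   R_k{n-2,n-1} satisfies R_k{c-1,c+1} = V - {c}; adding these m+2 inequalities gives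
   (m+1) h(V) >= m+2.

   Upper bounds: a uniform weight 1/c on a set S suffices as soon as every R_k{x,y}
   meets S in c points.  For n <= k+2 take an end vertex and c = 1.  For
   k+3 <= n <= 2k+3 take both ends and the m vertices above, with c = m+1.
   In general take the multiples of k+1 together with n-1, with c = 2: for
   x < y the nearest point of S on the left of x and the nearest one on the right of y
   both belong to R_k{x,y}. *)
Require Import Defs.
From HB Require Import structures.
From mathcomp Require Import all_boot all_order all_algebra.
From mathcomp Require Import classical_sets reals.
From mathcomp Require Import finset zify ring lra.
Set Implicit Arguments. Unset Strict Implicit. Unset Printing Implicit Defensive.
Import Order.TTheory GRing.Theory Num.Theory.
Local Open Scope ring_scope.

(** * Membership in the resolving sets of a path *)

Lemma Rk_sym k n (x y : 'I_n) : Rk k x y = Rk k y x.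
Proof. by apply/setP => z; rewrite !inE eq_sym. Qed.

Lemma Rk_left k n (x y z : 'I_n) :
  (z <= x)%N -> (x < y)%N -> (x <= z + k)%N -> z \in Rk k x y.
Proof. rewrite inE /dtrunc /path_dist; lia. Qed.

Lemma Rk_right k n (x y z : 'I_n) :
  (y <= z)%N -> (x < y)%N -> (z <= y + k)%N -> z \in Rk k x y.
Proof. rewrite inE /dtrunc /path_dist; lia. Qed.

(** Either the two distances agree, so [z] is the midpoint, or both are truncated to [k + 1], and
    then [z] lies beyond [y], before [x], or between them. *)
Lemma notin_Rk k n (x y z : 'I_n) : (x < y)%N -> z \notin Rk k x y ->
  [\/ (z + z = x + y)%N, (y + k < z)%N, (z + k < x)%N | (x + k < z)%N /\ (z + k < y)%N].
Proof.
move=> xy; rewrite inE negbK /dtrunc /path_dist => /eqP.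
case: (leqP z x) => zx; first by move=> e; apply: Or43; lia.
case: (leqP y z) => zy; first by move=> e; apply: Or42; lia.
case: (leqP (z - x) k) => xk e; first by apply: Or41; lia.
by apply: Or44; lia.
Qed.

(** * Estimating the infimum *)

Lemma dimkf_le (R : realType) k n (h : 'I_n -> R) :
  ktrunc_resolving k h -> dimkf R k n <= \sum_v h v.
Proof.
move=> hh; apply: ge_inf; last by exists h.
exists 0 => _ [g [[g01 _] ->]].
by apply: sumr_ge0 => v _; case/andP: (g01 v).
Qed.

Lemma dimkf_ge (R : realType) k n (c : R) :
  (forall h : 'I_n -> R, ktrunc_resolving k h -> c <= \sum_v h v) ->
  c <= dimkf R k n.
Proof.
move=> cle; apply: lb_le_inf; last by move=> _ [h [hh ->]]; apply: cle.
(* The constant weight 1 shows that the infimum is taken over a nonempty set. *)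
exists (\sum_(v : 'I_n) 1); exists (fun=> 1); split=> //; split=> [v|x y neq_xy].
  by rewrite ler01 lexx.
have xR : x \in Rk k x y.
  by move: neq_xy; rewrite -val_eqE inE /dtrunc /path_dist /=; lia.
by rewrite (bigD1 x) //= lerDl sumr_ge0.
Qed.

Lemma dimkf_le_uniform (R : realType) k n c (S : {set 'I_n}) :
  (0 < c)%N ->
  (forall x y : 'I_n, (x < y)%N -> (c <= #|S :&: Rk k x y|)%N) ->
  dimkf R k n <= #|S|%:R / c%:R.
Proof.
move=> c_gt0 cS.
have sumE (P : pred 'I_n) (A : {set 'I_n}) : A =i P ->
    \sum_(v | P v) (if v \in S then c%:R^-1 else 0) = #|S :&: A|%:R / c%:R :> R.
  move=> AP; rewrite -big_mkcondr /= sumr_const -[LHS]mulr_natl.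
  congr (_%:R * _); apply: eq_card => v.
  by rewrite !inE unfold_in /= [v \in A]AP andbC.
suff hh : ktrunc_resolving k (fun v : 'I_n => if v \in S then c%:R^-1 else 0 : R).
  apply: le_trans (dimkf_le hh) _.
  by rewrite (sumE _ setT) ?setIT // => v; rewrite inE.
split=> [v|x y neq_xy].
  case: ifP => _; last by rewrite lexx ler01.
  by rewrite invr_ge0 ler0n /= invf_le1 ?ltr0n // ler1n.
rewrite (sumE _ (Rk k x y)) // ler_pdivlMr ?ltr0n // mul1r ler_nat.
case: (ltngtP x y) => [xy|yx|xy]; first exact: cS.
  by rewrite Rk_sym; apply: cS.
by rewrite (val_inj xy) eqxx in neq_xy.
Qed.

(** * Upper bounds from explicit weights *)

Lemma dimkf_le_short (R : realType) k n :
  (0 < n)%N -> (n <= k + 2)%N -> dimkf R k n <= 1.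
Proof.
move=> n_gt0 nle; pose z := Ordinal n_gt0.
apply: le_trans (@dimkf_le_uniform R k n 1 [set z] _ _) _ => //.
  move=> x y xy; rewrite card_gt0; apply/set0Pn; exists z.
  rewrite in_setI set11 /=; apply: Rk_left => //=.
  by move: (ltn_ord y); lia.
by rewrite cards1 divr1.
Qed.

Lemma dimkf_le_mid (R : realType) k n :
  (k + 3 <= n <= 2 * k + 3)%N ->
  dimkf R k n <= (6 + 2 * k - n)%:R / (5 + 2 * k - n)%:R.
Proof.
(* The first and last index give the two ends; those between run through [n - (k + 2)], ...,
   [k + 1]. *)
move=> nk; pose f (i : 'I_(6 + 2 * k - n)) : nat :=
  if i == 0%N :> nat then 0%N else
  if i == (5 + 2 * k - n)%N :> nat then n.-1 else (n + i - (k + 3))%N.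
have f_lt i : (f i < n)%N.
  by move: (ltn_ord i); rewrite /f; do 2?case: ifP; lia.
pose S := [set Ordinal (f_lt i) | i : 'I_(6 + 2 * k - n)].
have Sval z : z \in S -> [|| z == 0%N :> nat, z == n.-1 :> nat
                            | (n - (k + 2) <= z <= k + 1)%N].
  by case/imsetP => i _ ->; move: (ltn_ord i); rewrite /= /f; do 2?case: ifP; lia.
have cardS : #|S| = (6 + 2 * k - n)%N.
  rewrite card_imset ?card_ord // => i j /(congr1 val) /=.
  move: (ltn_ord i) (ltn_ord j) => ilt jlt eq_f; apply: val_inj => /=.
  by move: eq_f; rewrite /f; do 4?case: ifP; lia.
apply: le_trans (@dimkf_le_uniform R k n (5 + 2 * k - n) S _ _) _; last 1 first.
- by rewrite cardS.
- by lia.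
move=> x y xy.
(* An inner point of [S] is missed only as the midpoint. If an end is missed, the midpoint is
   outside the inner block and the other end is in reach. *)
suff le1 : (#|S :\: Rk k x y| <= 1)%N.
  rewrite -(leq_add2r #|S :\: Rk k x y|) cardsID cardS.
  apply: leq_trans (_ : 5 + 2 * k - n + 1 <= _)%N; first by rewrite leq_add2l.
  by lia.
apply/card_le1_eqP => z w; rewrite !in_setD.
move=> /andP[zR /Sval zS] /andP[wR /Sval wS]; apply: val_inj.
move: (ltn_ord x) (ltn_ord y) (ltn_ord z) (ltn_ord w) => xn yn zn wn.
case/or3P: zS => zS; case/or3P: wS => wS;
  case: (notin_Rk xy zR) => zxy; case: (notin_Rk xy wR) => wxy; rewrite /=; lia.
Qed.

Lemma dimkf_le_long (R : realType) k n s :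
  (0 < n)%N -> (n <= s * k.+1 + 1)%N -> dimkf R k n <= (s + 1)%:R / 2.
Proof.
move=> n_gt0 ns; pose f (i : 'I_(s + 1)) := minn (i * k.+1) n.-1.
have f_lt i : (f i < n)%N by rewrite /f; lia.
pose S := [set Ordinal (f_lt i) | i : 'I_(s + 1)].
have cardS : (#|S| <= s + 1)%N.
  by apply: leq_trans (leq_imset_card _ _) _; rewrite card_ord.
apply: le_trans (@dimkf_le_uniform R k n 2 S _ _) _ => //; last first.
  by rewrite ler_pM2r ?invr_gt0 ?ltr0n // ler_nat.
move=> x y xy; move: (ltn_ord x) (ltn_ord y) => xn yn.
(* These indices round [x] down and [y] up to multiples of [k + 1], the latter capped at [n - 1]. *)
have x_lt : (x %/ k.+1 < s + 1)%N by rewrite ltn_divLR //; lia.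
have y_lt : ((y + k) %/ k.+1 < s + 1)%N by rewrite ltn_divLR //; lia.
have xE := divn_eq x k.+1; have xm := ltn_pmod x (ltn0Sn k).
have yE := divn_eq (y + k) k.+1; have ym := ltn_pmod (y + k) (ltn0Sn k).
pose zl := Ordinal (f_lt (Ordinal x_lt)); pose zr := Ordinal (f_lt (Ordinal y_lt)).
have zlE : (zl : nat) = (x %/ k.+1 * k.+1)%N by rewrite /= /f /=; lia.
have zrE : (zr : nat) = minn ((y + k) %/ k.+1 * k.+1) n.-1 by [].
have neq_z : zl != zr by apply/eqP => /(congr1 (@nat_of_ord n)); rewrite zlE zrE; lia.
suff sub : [set zl; zr] \subset S :&: Rk k x y.
  by have := subset_leq_card sub; rewrite cards2 neq_z.
apply/fintype.subsetP => z; rewrite in_setI in_set2 => /orP[]/eqP->; rewrite imset_f //=.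
  by apply: Rk_left => //; rewrite zlE; lia.
by apply: Rk_right => //; rewrite zrE; lia.
Qed.

(** * Lower bounds from packings *)

Section LowerBounds.
Variables (R : realType) (k n : nat) (h : 'I_n -> R).
Hypothesis hh : ktrunc_resolving k h.

Lemma resolving_ge0 v : 0 <= h v.
Proof. by case: hh => /(_ v)/andP[]. Qed.

(** Enlarging the resolving set to any [P] keeps the bound, as weights are nonnegative; with natural
    numbers the inclusion is left to [lia]. *)
Lemma resolving_sum_ge1 (P : pred nat) (x y : nat) :
  (x < y < n)%N ->
  (forall v, (v < n)%N ->
     minn ((x - v) + (v - x)) k.+1 != minn ((y - v) + (v - y)) k.+1 -> P v) ->
  1 <= \sum_(v : 'I_n | P v) h v.
Proof.
move=> /andP[xy yn] RP; have xn := ltn_trans xy yn.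
have neq_xy : Ordinal xn != Ordinal yn by rewrite -val_eqE /=; lia.
case: hh => _ /(_ _ _ neq_xy) /le_trans; apply.
rewrite big_mkcond [leRHS]big_mkcond; apply: ler_sum => v _.
rewrite inE /dtrunc /path_dist /=; case: ifP => [/RP -> //|_].
by case: ifP => // _; apply: resolving_ge0.
Qed.

(** From [a] on there is room for [b] intervals of length [2 * k + 2] and a last one of length
    [k + 2], given by the final edge. *)
Lemma right_packing_ge a b :
  n = (a + k + 2 + b * (2 * k + 2))%N ->
  (b + 1)%:R <= \sum_(v : 'I_n | (a <= v)%N) h v.
Proof.
elim: b a => [|b IHb] a nE.
  by apply: (@resolving_sum_ge1 (leq a) (n - 2) (n - 1)) => [|v]; lia.
have := IHb (a + (2 * k + 2))%N ltac:(lia) => le1.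
have le2 : 1 <= \sum_(v : 'I_n | (a <= v < a + (2 * k + 2))%N) h v.
  by apply: (@resolving_sum_ge1 (fun v => (a <= v < a + (2 * k + 2))%N)
               (a + k) (a + k + 1)) => [|v]; lia.
rewrite addSn -addn1 natrD addrC; apply: le_trans (lerD le2 le1) _.
rewrite big_mkcond [X in _ + X]big_mkcond [leRHS]big_mkcond -big_split /=.
apply: ler_sum => v _; have := resolving_ge0 v.
case: ifP => ?; case: ifP => ?; case: ifP => ?; rewrite ?(addr0, add0r) //; lia.
Qed.

Lemma packing_ge p :
  (2 <= p)%N -> ((p - 1) * (2 * k + 2) + 2 <= n)%N -> p%:R <= \sum_v h v.
Proof.
(* The right packing is flush with the end, so any slack falls between it and the first [k + 2]
   vertices. *)
move=> p2 np; pose a := (n - (k + 2 + (p - 2) * (2 * k + 2)))%N.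
have pE : ((p - 1) = (p - 2) + 1)%N by lia.
have n_gt1 : (1 < n)%N by apply: leq_trans np; rewrite leq_addl.
rewrite pE mulnDl in np.
have le1 := @right_packing_ge a (p - 2) ltac:(rewrite /a; lia).
have le2 : 1 <= \sum_(v : 'I_n | (v < k + 2)%N) h v.
  by apply: (@resolving_sum_ge1 (fun v => v < k + 2)%N 0 1) => [|v]; lia.
have a_ge : (k + 2 <= a)%N by rewrite /a; lia.
have -> : p%:R = 1 + (p - 2 + 1)%:R :> R by rewrite addrC natr1; congr _%:R; lia.
apply: le_trans (lerD le2 le1) _.
rewrite big_mkcond [X in _ + X]big_mkcond -big_split /=.
apply: ler_sum => v _; have := resolving_ge0 v.
case: ifP => ?; case: ifP => ?; rewrite ?(addr0, add0r) //; lia.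
Qed.

Lemma packing_ge_half q :
  (2 <= q)%N -> n = (q * (2 * k + 2) + 1)%N -> q%:R + 1 / 2 <= \sum_v h v.
Proof.
move=> q2 nE; have [r qE] : exists r, q = r.+2 by exists (q - 2)%N; lia.
have le1 := @right_packing_ge (k + 1) r.+1 ltac:(lia).
have le2 := @right_packing_ge (3 * k + 3) r ltac:(lia).
have le3 : 1 <= \sum_(v : 'I_n | (v < k + 2)%N) h v.
  by apply: (@resolving_sum_ge1 (fun v => v < k + 2)%N 0 1) => [|v]; lia.
have le4 : 1 <= \sum_(v : 'I_n | (v != k + 1 :> nat)%N && (v < 2 * k + 3)%N) h v.
  by apply: (@resolving_sum_ge1 (fun v => (v != k + 1) && (v < 2 * k + 3))%N
               k (k + 2)) => [|v]; lia.
(* No vertex is counted more than twice: the first two sets share only [k + 1], which the last two,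
   being disjoint, both avoid. *)
have : \sum_(v : 'I_n | (v < k + 2)%N) h v
     + \sum_(v : 'I_n | (k + 1 <= v)%N) h v
     + \sum_(v : 'I_n | (v != k + 1 :> nat)%N && (v < 2 * k + 3)%N) h v
     + \sum_(v : 'I_n | (3 * k + 3 <= v)%N) h v <= \sum_v h v + \sum_v h v.
  rewrite big_mkcond [X in _ + X + _ + _]big_mkcond [X in _ + X + _]big_mkcond.
  rewrite [X in _ + X <= _]big_mkcond -!big_split /=.
  apply: ler_sum => v _; have := resolving_ge0 v => v0.
  case: ifP => ?; case: ifP => ?; case: ifP => ?; case: ifP => ?; try lra; lia.
move: le1 le2; rewrite qE -[r.+2]addn2 -[r.+1]addn1 !natrD; lra.
Qed.

Lemma dimkf_mid_ge : (k + 3 <= n <= 2 * k + 3)%N ->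
  (6 + 2 * k - n)%:R <= (5 + 2 * k - n)%:R * \sum_v h v.
Proof.
move=> nk; pose m := (2 * k + 4 - n)%N.
have f_lt (i : 'I_m) : (n - (k + 2) + i < n)%N by move: (ltn_ord i); lia.
pose f i := Ordinal (f_lt i).
have f_inj : injective f by move=> i j /(congr1 val) /= ?; apply: val_inj => /=; lia.
have le1 : 1 <= \sum_(v : 'I_n | (v < k + 2)%N) h v.
  by apply: (@resolving_sum_ge1 (fun v => v < k + 2)%N 0 1) => [|v]; lia.
have le2 : 1 <= \sum_(v : 'I_n | (n - (k + 2) <= v)%N) h v.
  by apply: (@resolving_sum_ge1 (leq (n - (k + 2))) (n - 2) (n - 1)) => [|v]; lia.
have le3 (i : 'I_m) : 1 <= \sum_v h v - h (f i).
  rewrite (bigD1 (f i)) //= addrC addrK; move: (ltn_ord i) => im.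
  apply: (@resolving_sum_ge1 (fun v => v != f i)%N (f i - 1) (f i + 1)) => [|v];
    rewrite /=; lia.
have le4 : m%:R <= m%:R * \sum_v h v - \sum_i h (f i).
  rewrite -[m in X in X - _]card_ord mulr_natl -sumr_const -sumrB.
  rewrite -[X in X%:R]card_ord -sumr_const; exact: ler_sum.
(* The end intervals overlap in the vertices [f i], whose weights cancel against [le4]. *)
have : \sum_(v : 'I_n | (v < k + 2)%N) h v
     + \sum_(v : 'I_n | (n - (k + 2) <= v)%N) h v <= \sum_v h v + \sum_i h (f i).
  have -> : \sum_i h (f i) = \sum_(v in [set f i | i : 'I_m]) h v.
    by rewrite big_imset //= => i j _ _; apply: f_inj.
  rewrite big_mkcond [X in _ + X]big_mkcond [X in _ <= _ + X]big_mkcond.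
  rewrite -!big_split /=.
  apply: ler_sum => v _; have := resolving_ge0 v => v0.
  case: ifP => lev; case: ifP => gev; case: ifP => vf; try lra.
  have im : (v - (n - (k + 2)) < m)%N by move: (ltn_ord v); rewrite /m; lia.
  case/imsetP: vf; exists (Ordinal im) => //; apply: val_inj => /=; lia.
have -> : (6 + 2 * k - n = m + 2)%N by rewrite /m; lia.
have -> : (5 + 2 * k - n = m + 1)%N by rewrite /m; lia.
rewrite !natrD mulrDl mul1r; lra.
Qed.

End LowerBounds.

(** * The ceiling and the case distinction *)

Lemma ceilR_natdiv (R : realType) (n d p : nat) :
  (0 < d)%N -> (n <= p.+1 * d)%N -> (p * d < n)%N ->
  ceilR (n%:R / d%:R : R) = p.+1%:R.
Proof.
move=> d_gt0 le_n lt_n; rewrite /ceilR.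
suff -> : Num.ceil (n%:R / d%:R : R) = p.+1%:Z by rewrite -pmulrn.
apply: ceil_def; have d0 : 0 < d%:R :> R by rewrite ltr0n.
have -> : p.+1%:Z - 1 = p%:Z by lia.
by rewrite -!pmulrn ltr_pdivlMr // ler_pdivrMr // -!natrM ltr_nat ler_nat lt_n.
Qed.

Theorem theorem3p11 (R : realType) (k n : nat) :
  (0 < k)%N -> (2 <= n)%N ->
  [/\ ((n <= k + 2)%N -> dimkf R k n = 1),
      ((k + 3 <= n <= 2 * k + 3)%N ->
         dimkf R k n = (6 + 2 * k%:R - n%:R) / (5 + 2 * k%:R - n%:R)) &
      ((2 * k + 4 <= n)%N ->
       [/\ (n = 1 %[mod 2 * k + 2])%N ->
             dimkf R k n = (n%:R + k%:R) / (2 * k%:R + 2),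
           (exists j : nat, (2 <= j <= k + 2)%N /\ (n = j %[mod 2 * k + 2])%N) ->
             dimkf R k n = ceilR (n%:R / (2 * k%:R + 2)) &
           ((n = 0 %[mod 2 * k + 2])%N \/
            (exists j : nat, (k + 3 <= j <= 2 * k + 1)%N /\ (n = j %[mod 2 * k + 2])%N)) ->
             ceilR (n%:R / (2 * k%:R + 2)) <= dimkf R k n /\
             dimkf R k n <= ceilR (n%:R / (2 * k%:R + 2)) + 1 / 2])].
Proof.
move=> k_gt0 n_ge2; have n_gt0 : (0 < n)%N by lia.
split=> [nle|nk|nge].
- apply: le_anti; rewrite dimkf_le_short //=; apply: dimkf_ge => h hh.
  by apply: (@resolving_sum_ge1 R k n h hh xpredT 0 1) => //; lia.
- have -> : 6 + 2 * k%:R - n%:R = (6 + 2 * k - n)%:R :> R.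
    by rewrite natrB; [rewrite natrD natrM | lia].
  have -> : 5 + 2 * k%:R - n%:R = (5 + 2 * k - n)%:R :> R.
    by rewrite natrB; [rewrite natrD natrM | lia].
  apply: le_anti; rewrite dimkf_le_mid //=; apply: dimkf_ge => h hh.
  rewrite ler_pdivrMr; last by rewrite ltr0n; lia.
  by rewrite mulrC; apply: dimkf_mid_ge.
have dE : 2 * k%:R + 2 = (2 * k + 2)%:R :> R by rewrite natrD natrM.
have nE := divn_eq n (2 * k + 2); set q := (n %/ _)%N in nE.
have q_gt0 : (0 < q)%N by rewrite divn_gt0; lia.
(* This covers every residue except 1. *)
have bounds p : (p.+1 * (2 * k + 2) + 2 <= n <= p.+2 * (2 * k + 2))%N ->
    ceilR (n%:R / (2 * k%:R + 2)) = p.+2%:R :> R /\ p.+2%:R <= dimkf R k n.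
  move=> np; split; first by rewrite dE; apply: ceilR_natdiv; lia.
  by apply: dimkf_ge => h hh; apply: (@packing_ge R k n h hh); lia.
split=> [nmod|[j [jk nmod]]|nmod].
- rewrite (@modn_small 1) in nmod; last by lia.
  have q_ge2 : (2 <= q)%N by case: (q) q_gt0 nE => [|[]] //; lia.
  rewrite nmod in nE.
  have -> : (n%:R + k%:R) / (2 * k%:R + 2) = q%:R + 1 / 2 :> R.
    have : 0 <= k%:R :> R by exact: ler0n.
    by move=> k0; rewrite nE !natrD natrM natrD natrM; field; lra.
  apply: le_anti; apply/andP; split.
    apply: le_trans (@dimkf_le_long R k n (2 * q) n_gt0 _) _; first by lia.
    by rewrite natrD natrM; lra.
  by apply: dimkf_ge => h hh; apply: (@packing_ge_half R k n h hh).
- rewrite (@modn_small j) in nmod; last by lia.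
  rewrite nmod in nE; case: (q) q_gt0 nE => [//|p] _ nE.
  have [-> ge] := bounds p ltac:(lia); apply: le_anti; rewrite ge andbT.
  (* A residue of at most [k + 2] saves one multiple of [k + 1], hence the 1/2 lost in the last
     case. *)
  apply: le_trans (@dimkf_le_long R k n (2 * p + 3) n_gt0 _) _; first by lia.
  by rewrite -addnA -[p.+2]addn2 !(natrM, natrD); lra.
have [p np] : exists p, (p.+1 * (2 * k + 2) + 2 <= n <= p.+2 * (2 * k + 2))%N.
  (* For residue 0 the quotient is itself the ceiling, so [p] is one smaller than otherwise. *)
  case: nmod => [nmod|[j [jk nmod]]].
    rewrite mod0n in nmod; exists (q - 2)%N.
    by move: nge nE; rewrite nmod; case: (q) q_gt0 => [|[|r]] // _; rewrite ?subn2 /=; lia.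
  rewrite (@modn_small j) in nmod; last by lia.
  by rewrite nmod in nE; exists (q.-1); case: (q) q_gt0 nE => [//|r] _ /=; lia.
have [-> ge] := bounds p np; split=> //.
apply: le_trans (@dimkf_le_long R k n (2 * p + 4) n_gt0 _) _; first by lia.
by rewrite -addnA -[p.+2]addn2 !(natrM, natrD); lra.
Qed.
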